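(* Let $1\le p<\infty$. Let $\Pi=(t_k)_{k\in\mathbb{Z}}$ be a sampling sequence with constants $0<\delta\le\Delta$, and let $\chi$ be a kernel satisfying $(\chi1)$–$(\chi4)$, where in $(\chi3)$ the $\varphi$-function is $\psi(u)=u$, i.e. $|\chi(x,u)-\chi(x,v)|\le L(x)|u-v|$, with $L$ satisfying $(L1)$, $(L2)$ and $M_p(L):=\int_{\mathbb{R}}L(u)|u|^p\,du<+\infty$. Let $M_2>0$, $\theta_0>0$ be such that $\mathcal{T}_w(x)\le M_2w^{-\theta_0}$ for all $x\in\mathbb{R}$ and all sufficiently large $w$. Then for every $f\in L^p(\mathbb{R})$ and every sufficiently large $w>0$, $$\|S_wf-f\|_p\le\delta^{-1/p}[2m_{0,\Pi}(L)]^{(p-1)/p}\left[\|L\|_1+M_p(L)\right]^{1/p}\omega_p(f,1/w)+\delta^{-1/p}m_{0,\Pi}(L)\Delta^{1/p}\omega_p(f,\Delta/w)+M_2\|f\|_p\,w^{-\theta_0}.$$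
   Context: A $\varphi$-function is a continuous non-decreasing $\varphi:[0,\infty)\to[0,\infty)$ with $\varphi(0)=0$, $\varphi(u)>0$ for $u>0$, $\varphi(u)\to\infty$. A sampling sequence $\Pi=(t_k)$: strictly increasing reals, $t_k\to\pm\infty$ as $k\to\pm\infty$, with $\delta\le\Delta_k:=t_{k+1}-t_k\le\Delta$ for constants $0<\delta\le\Delta$. A kernel is $\chi:\mathbb{R}^2\to\mathbb{R}$ with: $(\chi1)$ $k\mapsto\chi(wx-t_k,u)\in\ell^1(\mathbb{Z})$ for all $x,u$, $w>0$; $(\chi2)$ $\chi(x,0)=0$; $(\chi3)$ measurable $L:\mathbb{R}\to[0,\infty)$ and a $\varphi$-function $\psi$ with $|\chi(x,u)-\chi(x,v)|\le L(x)\psi(|u-v|)$; $(\chi4)$ some $\theta_0>0$ with $\mathcal{T}_w(x):=\sup_{u\ne0}\left|\frac1u\sum_k\chi(wx-t_k,u)-1\right|=\mathcal{O}(w^{-\theta_0})$ as $w\to\infty$ uniformly in $x$. $(L1)$: $L\in L^1(\mathbb{R})$, bounded near $0$; $(L2)$: some $\beta_0>0$ with $\sup_u\sum_kL(u-t_k)|u-t_k|^{\beta_0}<\infty$. $m_{0,\Pi}(L):=\sup_{u\in\mathbb{R}}\sum_kL(u-t_k)$ (finite). Operators: $(S_wf)(x):=\sum_k\chi\!\left(wx-t_k,\frac{w}{\Delta_k}\int_{t_k/w}^{t_{k+1}/w}f(u)\,du\right)$. $L^p$-modulus of smoothness: $\omega_p(f,\delta'):=\sup_{|h|\le\delta'}\|f(\cdot+h)-f(\cdot)\|_p$.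 *)

(* Defs.v *)
From HB Require Import structures.
From mathcomp Require Import all_boot all_order all_algebra.
From mathcomp Require Import all_classical all_reals all_analysis.
Set Implicit Arguments. Unset Strict Implicit. Unset Printing Implicit Defensive.
Import Order.TTheory GRing.Theory Num.Theory.
Import numFieldNormedType.Exports.
Local Open Scope classical_set_scope.
Local Open Scope ring_scope.

Section Defs.
Variable R : realType.

Definition summable_Z (a : int -> R) : Prop :=
  (\esum_(k in [set: int]) (`|a k|)%:E < +oo)%E.

Definition sum_Z (a : int -> R) : R :=
  fine (\esum_(k in [set: int]) (Num.max (a k) 0)%:E)
  - fine (\esum_(k in [set: int]) (Num.max (- a k) 0)%:E).

Definition sampling_sequence (t : int -> R) (delta Delta : R) : Prop :=
  [/\ 0 < delta, delta <= Delta,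
      (forall k : int, t k < t (k + 1)) &
      (forall k : int, delta <= t (k + 1) - t k <= Delta)].

Definition m0 (t : int -> R) (L : R -> R) : R :=
  fine (ereal_sup (range (fun u : R =>
          \esum_(k in [set: int]) (L (u - t k))%:E))).

Definition normL1 (L : R -> R) : R :=
  fine (\int[lebesgue_measure]_(x in [set: R]) (`|L x|)%:E)%E.

Definition Mp (p : R) (L : R -> R) : \bar R :=
  (\int[lebesgue_measure]_(u in [set: R]) (L u * `|u| `^ p)%:E)%E.

Definition Lpnorm (p : R) (f : R -> R) : \bar R :=
  Lnorm lebesgue_measure p%:E (EFin \o f).

Definition in_Lp (p : R) (f : R -> R) : Prop :=
  measurable_fun [set: R] f /\ (Lpnorm p f < +oo)%E.

Definition omega_p (p : R) (f : R -> R) (d : R) : \bar R :=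
  ereal_sup [set Lpnorm p (fun x => f (x + h) - f x) | h in [set h : R | `|h| <= d]].

Definition cell_of (t : int -> R) (w : R) (k : int) : set R :=
  `[t k / w, t (k + 1) / w]%classic.

Definition S_op (chi : R -> R -> R) (t : int -> R) (w : R) (f : R -> R) (x : R) : R :=
  sum_Z (fun k => chi (w * x - t k)
     (w / (t (k + 1) - t k) *
        fine (\int[lebesgue_measure]_(u in cell_of t w k) (f u)%:E)%E)).

End Defs.

(* Main.v *)
Require Import Defs.
From HB Require Import structures.
From mathcomp Require Import all_boot all_order all_algebra.
From mathcomp Require Import all_classical all_reals all_analysis.
From mathcomp Require Import measurable_realfun ring lra.
Set Implicit Arguments. Unset Strict Implicit. Unset Printing Implicit Defensive.
Import Order.TTheory GRing.Theory Num.Theory.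
Import numFieldNormedType.Exports.
Local Open Scope classical_set_scope.
Local Open Scope ring_scope.

(** Write [c_k] for the inverse length of the cell [t_k/w, t_(k+1)/w].  By (chi3)
  and (chi4), [S_w f x - f x] is at most [M2 w^-theta0 |f x|] plus the sum over [k]
  of [L (w x - t_k)] times the distance from [f x] to the average of [f] on the
  [k]-th cell.  Inserting the translate [f (u + x - t_k/w)] under the average and
  applying Jensen on the cell bounds that distance by [A_k(x)^(1/p) + B(x)^(1/p)],
  where
    [A_k(x) = c_k int_(cell k) |f (u + x - t_k/w) - f u|^p du],
    [B(x) = (w/delta) int_[0, Delta/w] |f (x + s) - f x|^p ds].
  Since the weights [L (w x - t_k)] have sum at most [m0], Jensen for this sum
  leaves [(m0^(p-1) J1(x))^(1/p) + m0 B(x)^(1/p)] with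
  [J1(x) = sum_k L (w x - t_k) A_k(x)].
  Tonelli bounds the integral of [B] by [delta^-1 Delta omega_p(f, Delta/w)^p].
  In the integral of [J1] the substitution [y = x - t_k/w] makes the kernel
  independent of [k], so the cells reassemble into the norm of [f (. + y) - f],
  which is at most [(1 + w |y|) omega_p(f, 1/w)]; rescaling and
  [(1 + |z|)^p <= 2^(p-1) (1 + |z|^p)] give the constant of the first term.
  As [chi] need not be measurable in its first variable, the norm of [S_w f - f]
  is compared with that of a measurable pointwise majorant. *)

(** * Integrals *)

Local Open Scope ereal_scope.
Local Notation mu := lebesgue_measure.

Section upper_integral.
Import HBNNSimple.

(** The integral of a nonnegative function is the supremum of the integrals of the simple functions
    below it, and a simple function below [f] is below [g]. The comparison thus covers nonmeasurable
    functions, as [S_op chi t w f] may be. *)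
Lemma ge0_le_integral_upper d (T : measurableType d) (R : realType)
    (m : {measure set T -> \bar R}) (f g : T -> \bar R) :
  (forall x, 0 <= f x) -> (forall x, f x <= g x) ->
  \int[m]_x f x <= \int[m]_x g x.
Proof.
move=> f0 fg; have g0 x : 0 <= g x by exact: le_trans (fg x).
rewrite !ge0_integralTE//; apply: ge_ereal_sup => _ [h /= hf <-].
by apply: ereal_sup_ubound; exists h => // x; exact: le_trans (fg x).
Qed.
End upper_integral.

Section affine.
Context {R : realType}.

(** By uniqueness of Lebesgue measure: [a] times the image of [mu] under the affine map is a measure
    agreeing with [mu] on half-open intervals. *)
Lemma lebesgue_measure_affine (a b : R) (A : set R) : (0 < a)%R ->
  measurable A -> a%:E * mu ((fun x => a * x + b)%R @^-1` A) = mu A.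
Proof.
move=> a0 mA; pose phi := (fun x => a * x + b)%R : measurableTypeR R ->
  measurableTypeR R.
have mphi : measurable_fun setT phi.
  by apply: measurable_funD => //; exact: measurable_funM.
suff h : forall X, ocitv X -> mu X = a%:E * mu (phi @^-1` X).
  by apply/esym; unshelve refine (@lebesgue_measure_unique R (mscale (NngNum (ltW a0)) (pushforward mu phi)) h A mA).
move=> _ [[c d]] _ <-.
rewrite [X in _ = _ * mu X](_ : _ = `](c - b) / a, (d - b) / a]%classic)%R; last first.
  apply/seteqP; split => x /=; rewrite !in_itv/= /phi.
    by rewrite ltr_pdivrMr// ler_pdivlMr// ltrBlDr lerBrDr mulrC.
  by rewrite ltr_pdivrMr// ler_pdivlMr// ltrBlDr lerBrDr mulrC.
rewrite /= !lebesgue_measure_itv/= !lte_fin ltr_pM2r ?invr_gt0// ltrD2r.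
case: ifPn => _; last by rewrite mule0.
by rewrite -!EFinD -EFinM; congr EFin; field; rewrite gt_eqF.
Qed.

Lemma ge0_integral_affine (a b : R) (f : R -> \bar R) : (0 < a)%R ->
  measurable_fun [set: R] f -> (forall x, 0 <= f x) ->
  a%:E * \int[mu]_x f (a * x + b)%R = \int[mu]_x f x.
Proof.
move=> a0 mf f0.
pose phi := (fun x => a * x + b)%R : measurableTypeR R -> measurableTypeR R.
have mphi : measurable_fun setT phi.
  by apply: measurable_funD => //; exact: measurable_funM.
have -> : \int[mu]_x f (a * x + b)%R = \int[pushforward mu phi]_y f y.
  by rewrite (@ge0_integral_pushforward _ _ _ (measurableTypeR R)).
rewrite -[a]/((NngNum (ltW a0))%:num)%R -(ge0_integral_mscale)//.
by apply: eq_measure_integral => //= A mA AS; exact: lebesgue_measure_affine.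
Qed.

Lemma ge0_integral_translation (b : R) (f : R -> \bar R) :
  measurable_fun [set: R] f -> (forall x, 0 <= f x) ->
  \int[mu]_x f (x + b)%R = \int[mu]_x f x.
Proof.
move=> mf f0; rewrite -(@ge0_integral_affine 1 b f)//.
by rewrite mul1e; under [RHS]eq_integral do rewrite mul1r.
Qed.

End affine.

(** Hölder with exponents [q] and [p] for the factors [v^(1/q)] and [v^(1/p) g]. It serves twice:
    with Lebesgue measure for averages over a cell, with counting measure for series weighted by
    [L]. *)
Lemma integral_jensen_powR d (T : measurableType d) (R : realType)
    (m : {measure set T -> \bar R}) (p c : R) (v g : T -> R) :
  (1 <= p)%R -> measurable_fun [set: T] v -> measurable_fun [set: T] g ->
  (forall x, 0 <= v x)%R -> (forall x, 0 <= g x)%R ->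
  \int[m]_x (v x)%:E <= c%:E ->
  \int[m]_x (v x * g x)%:E <=
    ((c `^ (p - 1))%:E * \int[m]_x (v x * g x `^ p)%:E) `^ p^-1.
Proof.
move=> p1 mv mg v0 g0 vc.
(* [p = 1] has no finite conjugate exponent; here both sides coincide. *)
have [->|pn1] := eqVneq p 1%R.
  rewrite subrr powRr0 mul1e invr1 poweRe1; last first.
    by apply: integral_ge0 => x _; rewrite lee_fin mulr_ge0// powR_ge0.
  by under [leRHS]eq_integral do rewrite powRr1//.
have {pn1 p1} p1 : (1 < p)%R by rewrite lt_neqAle eq_sym pn1.
have p0 : (0 < p)%R by exact: lt_trans p1.
have p10 : (0 < p - 1)%R by rewrite subr_gt0.
pose q := (p / (p - 1))%R.
have q0 : (0 < q)%R by rewrite divr_gt0.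
have pq : (q^-1 + p^-1 = 1)%R.
  by rewrite /q; field; rewrite !gt_eqF.
have c0 : (0 <= c)%R.
  by rewrite -lee_fin (le_trans _ vc)//; apply: integral_ge0 => x _; rewrite lee_fin.
have mpow r (h : T -> R) : measurable_fun setT h ->
    measurable_fun setT (fun x => h x `^ r)%R.
  exact: (@measurableT_comp _ _ _ _ _ _ (@powR R ^~ r)).
have := @hoelder _ _ _ m (fun x => v x `^ q^-1)%R (fun x => v x `^ p^-1 * g x)%R q p
  (mpow _ _ mv) (measurable_funM (mpow _ _ mv) mg) q0 p0 pq.
rewrite Lnorm1 => /=.
under eq_integral => x _.
  rewrite /= mulrA -powRD; last by rewrite pq oner_eq0.
  rewrite pq powRr1// ger0_norm ?mulr_ge0//.
  over.
move=> /le_trans; apply.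
rewrite poweRM; [|by rewrite lee_fin powR_ge0|by apply: integral_ge0 => x _;
  rewrite lee_fin mulr_ge0 ?powR_ge0].
rewrite unlock; apply: lee_pmul; rewrite ?poweR_ge0//.
- under eq_integral => x _.
    rewrite /= ger0_norm ?powR_ge0// -powRrM mulVf ?gt_eqF// powRr1//.
    over.
  rewrite poweR_EFin -powRrM.
  have -> : ((p - 1) * p^-1 = q^-1)%R by rewrite /q invf_div.
  rewrite -poweR_EFin; apply: gt0_ler_poweR => //.
  - by rewrite invr_ge0 ltW.
  - by rewrite in_itv/= leey andbT; apply: integral_ge0 => x _; rewrite lee_fin.
  - by rewrite in_itv/= leey andbT lee_fin.
- under eq_integral => x _.
    rewrite /= ger0_norm ?mulr_ge0 ?powR_ge0// powRM ?powR_ge0// -powRrM mulVf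
      ?gt_eqF// powRr1//.
    over.
  exact: lexx.
Qed.

Lemma nneseries_jensen_powR (R : realType) (p c : R) (v g : nat -> R) :
  (1 <= p)%R -> (forall n, 0 <= v n)%R -> (forall n, 0 <= g n)%R ->
  \sum_(n <oo) (v n)%:E <= c%:E ->
  \sum_(n <oo) (v n * g n)%:E <=
    ((c `^ (p - 1))%:E * \sum_(n <oo) (v n * g n `^ p)%:E) `^ p^-1.
Proof.
move=> p1 v0 g0 vc; rewrite -!ge0_integral_count//.
- by apply: integral_jensen_powR; rewrite ?ge0_integral_count.
- by move=> n; rewrite lee_fin mulr_ge0 ?powR_ge0.
- by move=> n; rewrite lee_fin mulr_ge0.
Qed.

Section interval.
Context {R : realType}.

Lemma integral_indicM (D : set R) (h : R -> R) :
  \int[mu]_(x in D) (h x)%:E = \int[mu]_x (\1_D x * h x)%:E.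
Proof.
rewrite integral_mkcond; apply: eq_integral => x _.
by rewrite /patch indicE; case: ifPn; rewrite ?mul1r ?mul0r.
Qed.

Lemma average_jensen_powR (p a b : R) (g : R -> R) :
  (1 <= p)%R -> (a < b)%R -> measurable_fun [set: R] g -> (forall x, 0 <= g x)%R ->
  ((b - a)^-1)%:E * \int[mu]_(x in `[a, b]) (g x)%:E <=
    (((b - a)^-1)%:E * \int[mu]_(x in `[a, b]) (g x `^ p)%:E) `^ p^-1.
Proof.
move=> p1 ab mg g0.
have ba0 : (0 < (b - a)^-1)%R by rewrite invr_gt0 subr_gt0.
have mgp : measurable_fun setT (fun x => g x `^ p)%R.
  exact: (@measurableT_comp _ _ _ _ _ _ (@powR R ^~ p)).
pose v (x : R) : R := ((b - a)^-1 * \1_`[a, b] x)%R.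
have h (f : R -> R) : measurable_fun setT f -> (forall x, 0 <= f x)%R ->
    ((b - a)^-1)%:E * \int[mu]_(x in `[a, b]) (f x)%:E = \int[mu]_x (v x * f x)%:E.
  move=> mf f0; rewrite integral_indicM -ge0_integralZl//.
  - by apply: eq_integral => x _; rewrite /v -EFinM mulrA.
  - by apply/measurable_EFinP/measurable_funM.
  - by move=> x _; rewrite lee_fin mulr_ge0.
  - by rewrite lee_fin ltW.
rewrite !h//; last by move=> x; rewrite powR_ge0.
have := @integral_jensen_powR _ _ _ mu p 1 v g p1.
rewrite powR1 mul1e; apply => //.
- exact: measurable_funM.
- by move=> x; rewrite mulr_ge0// ltW.
have := h (cst 1%R) (measurable_cst _) (fun=> ler01).
under [X in _ = X -> _]eq_integral do rewrite mulr1.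
have -> : \int[mu]_(x in `[a, b]) (@cst R R 1%R x)%:E = (b - a)%:E.
  have := @integral_cst _ _ _ (@mu R) `[a, b]%classic (measurable_itv _) 1.
  by rewrite /= lebesgue_measure_itv/= lte_fin ab mul1e -EFinD; apply.
by move=> <-; rewrite -EFinM mulVf// subr_eq0 gt_eqF.
Qed.

End interval.

(** * Series over the integers *)

Definition int_of_nat (n : nat) : int := if odd n then Negz n./2 else Posz n./2.

Lemma int_of_nat_bij : set_bij [set: nat] [set: int] int_of_nat.
Proof.
split => // [m n _ _|[n|n] _].
- rewrite /int_of_nat => mn; rewrite -(odd_double_half m) -(odd_double_half n).
  by case: (odd m) (odd n) mn => [] [] // -[->].
- by exists n.*2 => //; rewrite /int_of_nat odd_double doubleK.
- by exists n.*2.+1 => //; rewrite /int_of_nat/= odd_double/= uphalf_double.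
Qed.

(** The enumeration [0, -1, 1, -2, 2, ...] turns sums over [int] into series, for which Jensen and
    the exchange with integrals are available. *)
Lemma esum_int_nneseries (R : realType) (a : int -> \bar R) :
  (forall k, 0 <= a k) ->
  \esum_(k in [set: int]) a k = \sum_(n <oo) a (int_of_nat n).
Proof.
by move=> a0; rewrite nneseries_esumT// (reindex_esum _ _ _ _ int_of_nat_bij).
Qed.

(** Since [x = x^+ - x^-], this is [x - y <= |x - y|] with the negative parts moved across. *)
Lemma maxrN0_le_dist (R : realType) (x y : R) :
  (Num.max x 0 + Num.max (- y) 0 <= Num.max y 0 + Num.max (- x) 0 + `|x - y|)%R.
Proof.
have mx (u : R) : (Num.max u 0 = u + Num.max (- u) 0)%R.
  by have [?|?] := lerP u 0; have [?|?] := lerP (- u) 0; lra.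
by rewrite (mx x) (mx y); have := ler_norm (x - y); lra.
Qed.

(* Comparing positive parts with [a^+ + b^- <= b^+ + a^- + |a - b|] avoids any
   additivity statement for [sum_Z]. *)
Lemma sum_Z_dist (R : realType) (a b : int -> R) :
  summable_Z a -> summable_Z b ->
  (`|sum_Z a - sum_Z b|)%:E <= \esum_(k in [set: int]) (`|a k - b k|)%:E.
Proof.
suff h (c d : int -> R) : summable_Z c -> summable_Z d ->
    (sum_Z c - sum_Z d)%:E <= \esum_(k in [set: int]) (`|c k - d k|)%:E.
  move=> sa sb; have [_|_] := ler0P (sum_Z a - sum_Z b); last exact: h.
  rewrite opprB; apply: (le_trans (h _ _ sb sa)).
  by apply: le_esum => k _; rewrite distrC.
move=> sc sd; rewrite /sum_Z.
have fin (u : int -> R) : summable_Z u ->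
    (\esum_(k in [set: int]) (Num.max (u k) 0)%:E \is a fin_num)
    * (\esum_(k in [set: int]) (Num.max (- u k) 0)%:E \is a fin_num).
  move=> su; split; rewrite ge0_fin_numE.
  - apply: le_lt_trans su; apply: le_esum => k _.
    by rewrite lee_fin ge_max normr_ge0 ler_norm.
  - by apply: esum_ge0 => k _; rewrite lee_fin le_max lexx orbT.
  - apply: le_lt_trans su; apply: le_esum => k _.
    by rewrite lee_fin ge_max normr_ge0 -normrN ler_norm.
  - by apply: esum_ge0 => k _; rewrite lee_fin le_max lexx orbT.
have [cp cn] := fin _ sc; have [dp dn] := fin _ sd.
have pos (u : int -> R) k : 0 <= (Num.max (u k) 0)%:E
  by rewrite lee_fin le_max lexx orbT.
have : \esum_(k in [set: int]) (Num.max (c k) 0)%:E + \esum_(k in [set: int]) (Num.max (- d k) 0)%:E <=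
    \esum_(k in [set: int]) (Num.max (d k) 0)%:E + \esum_(k in [set: int]) (Num.max (- c k) 0)%:E
    + \esum_(k in [set: int]) (`|c k - d k|)%:E.
  rewrite -!esumD; do ?[by move=> k _; rewrite ?adde_ge0 ?(pos
    (fun k => - d k)%R) ?(pos (fun k => - c k)%R)].
  by apply: le_esum => k _; rewrite -!EFinD lee_fin maxrN0_le_dist.
rewrite -(fineK cp) -(fineK cn) -(fineK dp) -(fineK dn) /= -!EFinD.
case: (\esum_(k in [set: int]) (`|c k - d k|)%:E) => [u| |].
- by rewrite -EFinD !lee_fin; lra.
- by move=> _; rewrite leey.
- by rewrite addeNy leeNy_eq.
Qed.

(** * Translations in L^p *)

Section Lp.
Context {R : realType} (p : R) (p1 : (1 <= p)%R).
Implicit Types f g : R -> R.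

Let p0 : (0 < p)%R. Proof. exact: lt_le_trans p1. Qed.

Lemma measurable_normr_powR f : measurable_fun [set: R] f ->
  measurable_fun [set: R] (fun x => `|f x| `^ p)%R.
Proof.
move=> mf; apply: (@measurableT_comp _ _ _ _ _ _ (@powR R ^~ p)) => //.
exact: measurableT_comp.
Qed.

Lemma measurable_translation f h : measurable_fun [set: R] f ->
  measurable_fun [set: R] (fun x => f (x + h))%R.
Proof. by move=> mf; apply: measurableT_comp => //; exact: measurable_funD. Qed.

Lemma LpnormE f : Lpnorm p f = (\int[mu]_x (`|f x| `^ p)%:E) `^ p^-1.
Proof. by rewrite /Lpnorm unlock. Qed.

Lemma Lpnorm_powR f : (Lpnorm p f) `^ p = \int[mu]_x (`|f x| `^ p)%:E.
Proof. by rewrite /Lpnorm poweR_Lnorm ?gt_eqF. Qed.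

Lemma Lpnorm_ge0 f : 0 <= Lpnorm p f.
Proof. exact: Lnorm_ge0. Qed.

Lemma le_Lpnorm f g : (forall x, `|f x| <= g x)%R -> Lpnorm p f <= Lpnorm p g.
Proof.
move=> fg; rewrite !LpnormE; apply: gt0_ler_poweR.
- by rewrite invr_ge0 ltW.
- by rewrite in_itv/= leey andbT; apply: integral_ge0 => x _; rewrite lee_fin powR_ge0.
- by rewrite in_itv/= leey andbT; apply: integral_ge0 => x _; rewrite lee_fin powR_ge0.
- apply: ge0_le_integral_upper => x; rewrite lee_fin ?powR_ge0//.
  have gx : (0 <= g x)%R by exact: le_trans (fg x).
  by apply: ge0_ler_powR; rewrite ?nnegrE ?(ltW p0)// (ger0_norm gx).
Qed.

Lemma LpnormD f g : measurable_fun [set: R] f -> measurable_fun [set: R] g ->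
  Lpnorm p (fun x => f x + g x)%R <= Lpnorm p f + Lpnorm p g.
Proof. by move=> mf mg; exact: minkowski_EFin. Qed.

Lemma LpnormN f : Lpnorm p (fun x => - f x)%R = Lpnorm p f.
Proof. by rewrite !LpnormE; under eq_integral do rewrite normrN. Qed.

Lemma LpnormZ f (c : R) : measurable_fun [set: R] f -> (0 <= c)%R ->
  Lpnorm p (fun x => c * f x)%R = c%:E * Lpnorm p f.
Proof.
move=> mf c0; rewrite !LpnormE.
under eq_integral do rewrite normrM powRM// EFinM.
rewrite ge0_integralZl_EFin//.
- rewrite poweRM ?lee_fin ?powR_ge0//; last by apply: integral_ge0 => x _;
    rewrite lee_fin powR_ge0.
  by rewrite poweR_EFin -powRrM divff ?gt_eqF// powRr1// ger0_norm.
- by apply/measurable_EFinP; exact: measurable_normr_powR.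
Qed.

Lemma Lpnorm_translation f h : measurable_fun [set: R] f ->
  Lpnorm p (fun x => f (x + h))%R = Lpnorm p f.
Proof.
move=> mf; rewrite LpnormE [RHS]LpnormE -[in RHS](@ge0_integral_translation _ h)//.
- by apply/measurable_EFinP; exact: measurable_normr_powR.
Qed.

Lemma measurable_diff f h : measurable_fun [set: R] f ->
  measurable_fun [set: R] (fun x => f (x + h) - f x)%R.
Proof. by move=> mf; apply: measurable_funB => //; exact: measurable_translation. Qed.

Lemma Lpnorm_diff_le f h : measurable_fun [set: R] f ->
  Lpnorm p (fun x => f (x + h) - f x)%R <= 2%:E * Lpnorm p f.
Proof.
move=> mf; apply: (le_trans (@LpnormD (fun x => f (x + h))%R (fun x => - f x)%R _ _)).
- exact: measurable_translation.
- exact: measurableT_comp.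
- by rewrite LpnormN Lpnorm_translation// [in leRHS](natrD _ 1 1) EFinD ge0_muleDl
    ?lee_fin// !mul1e.
Qed.

Lemma omega_p_ge f h d : (`|h| <= d)%R ->
  Lpnorm p (fun x => f (x + h) - f x)%R <= omega_p p f d.
Proof. by move=> hd; apply: ereal_sup_ubound; exists h. Qed.

Lemma omega_p_ge0 f d : (0 <= d)%R -> 0 <= omega_p p f d.
Proof.
move=> d0; apply: (le_trans (Lpnorm_ge0 (fun x => f (x + 0) - f x)%R)).
by apply: omega_p_ge; rewrite normr0.
Qed.

(** A crude bound, used to see that the modulus of smoothness of an L^p function is finite. *)
Lemma omega_p_le f d : measurable_fun [set: R] f -> omega_p p f d <= 2%:E * Lpnorm p f.
Proof. by move=> mf; apply: ge_ereal_sup => _ [h _ <-]; exact: Lpnorm_diff_le. Qed.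

(** The difference telescopes into [n] steps of size [h], whose norms are all equal by translation
    invariance. *)
Lemma Lpnorm_diffMn f h n : measurable_fun [set: R] f ->
  Lpnorm p (fun x => f (x + n%:R * h) - f x)%R <=
  n%:R%:E * Lpnorm p (fun x => f (x + h) - f x)%R.
Proof.
move=> mf; elim: n => [|n IH].
  rewrite mul0e LpnormE; under eq_integral do rewrite mul0r addr0 subrr normr0 powR0
    ?gt_eqF//.
  by rewrite integral0 poweR0r// invr_neq0// gt_eqF.
rewrite -natr1 EFinD ge0_muleDl ?lee_fin// mul1e.
have -> : (fun x => f (x + (n%:R + 1) * h) - f x)%R =
  (fun x => (f ((x + h) + n%:R * h) - f (x + h)) + (f (x + h) - f x))%R.
  apply/funext => x; rewrite [(_ + n%:R * h)%R](_ : _ = x + (n%:R + 1) * h)%R;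
    first by rewrite subrKA.
  by rewrite mulrDl mul1r addrAC addrA.
apply: (le_trans (@LpnormD (fun x => f (x + h + n%:R * h) - f (x + h))%R
  (fun x => f (x + h) - f x)%R _ _));
  last apply: leeD => //.
- exact: (@measurable_translation (fun x => f (x + n%:R * h) - f x)%R h (measurable_diff _ mf)).
- exact: measurable_diff.
- by rewrite (@Lpnorm_translation (fun x => f (x + n%:R * h) - f x)%R)//;
    exact: measurable_diff.
Qed.

(** The shift [y] is cut into [n = floor(|y| / d) + 1] equal steps: each is of length at most [d],
    and [n <= 1 + |y| / d]. *)
Lemma Lpnorm_diff_omega f y d : measurable_fun [set: R] f -> (0 < d)%R ->
  Lpnorm p (fun x => f (x + y) - f x)%R <= (1 + `|y| / d)%:E * omega_p p f d.
Proof.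
move=> mf d0; set n := (Num.trunc (`|y| / d)).+1.
have yd0 : (0 <= `|y| / d)%R by rewrite divr_ge0// ltW.
have n0 : (0 < n%:R :> R)%R by rewrite ltr0n.
have := @Lpnorm_diffMn f (y / n%:R) n mf.
rewrite mulrCA divff ?gt_eqF// mulr1 => /le_trans; apply.
apply: lee_pmul; rewrite ?Lpnorm_ge0 ?lee_fin//.
- by rewrite /n -natr1 addrC lerD2l truncn_le.
- apply: omega_p_ge; rewrite normrM normfV (ger0_norm (ltW n0)).
  by rewrite ler_pdivrMr// mulrC -ler_pdivrMr// ltW// truncnS_gt.
Qed.

(** Jensen bounds the mean of [|f|] by the [p]-th root of the mean of [|f|^p]. Integrability on
    cells ensures that [fine] in [S_op] returns genuine integrals. *)
Lemma in_Lp_itv_integrable f (a b : R) : in_Lp p f -> (a < b)%R ->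
  mu.-integrable `[a, b] (EFin \o f).
Proof.
move=> [mf foo] ab; apply/integrableP; split.
  by apply/measurable_EFinP; exact: measurable_funTS.
have ba0 : (0 < (b - a)^-1)%R by rewrite invr_gt0 subr_gt0.
have := @average_jensen_powR R p a b (fun x => `|f x|)%R p1 ab (measurableT_comp
  (@normr_measurable _ _) mf) (fun=> normr_ge0 _).
move=> h.
suff : ((b - a)^-1)%:E * \int[mu]_(x in `[a, b]) (`|f x|)%:E < +oo.
  apply: contraTT; rewrite -!leNgt !leye_eq => /eqP /= ->.
  by rewrite gt0_muley// lte_fin.
apply: (le_lt_trans h); apply: poweR_lty.
apply: lte_mul_pinfty; rewrite ?lee_fin ?ltW//.
apply: (@le_lt_trans _ _ (\int[mu]_x (`|f x| `^ p)%:E)).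
  apply: ge0_subset_integral => //.
  - by apply/measurable_EFinP; exact: measurable_normr_powR.
by rewrite -Lpnorm_powR; apply: poweR_lty; exact: foo.
Qed.

Lemma average_dist f (a b y : R) : (a < b)%R -> mu.-integrable `[a, b] (EFin \o f) ->
  (`| (b - a)^-1 * fine (\int[mu]_(u in `[a, b]) (f u)%:E) - y |)%:E <=
  ((b - a)^-1)%:E * \int[mu]_(u in `[a, b]) (`|f u - y|)%:E.
Proof.
move=> ab fi.
have ba0 : (0 < (b - a)^-1)%R by rewrite invr_gt0 subr_gt0.
have muD : mu (`[a, b]%classic : set R) = (b - a)%:E.
  by rewrite lebesgue_measure_itv/= lte_fin ab -EFinD.
have yi : mu.-integrable `[a, b] (EFin \o cst y).
  apply: measurable_bounded_integrable => //.
    by rewrite [ltLHS]muD ltry.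
  by exists `|y|%R; split => // M yM x _ /=; exact: ltW.
have fyi : mu.-integrable `[a, b] (EFin \o (fun u => f u - y)%R).
  by have := integrableB (measurable_itv `[a, b] : measurable (_ : set (measurableTypeR R))) fi yi.
have -> : ((b - a)^-1 * fine (\int[mu]_(u in `[a, b]) (f u)%:E) - y =
   (b - a)^-1 * \int[mu]_(u in `[a, b]) (f u - y))%R.
  have -> : (\int[mu]_(u in `[a, b]) (f u - y) =
    fine (\int[mu]_(u in `[a, b]) (f u)%:E) - y * (b - a))%R.
    have mD : measurable (`[a, b]%classic : set (measurableTypeR R))
      by exact: measurable_itv.
    apply: (etrans (RintegralB mD fi yi)); congr (_ - _)%R.
    exact: (etrans (Rintegral_cst _ mD y) (congr1 (fun e => y * fine e)%R muD)).
  by field; rewrite subr_eq0 gt_eqF.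
rewrite normrM (ger0_norm (ltW ba0)) EFinM lee_pmul2l// ?lte_fin//.
rewrite EFin_normr_Rintegral//; apply: le_abse_integral => //.
exact: (measurable_int _ fyi).
Qed.

(** The intermediate value is [f (u + (x - a))]: its argument is a translate of [u] by an amount
    independent of [u], and runs from [x] to [x + (b - a)] as [u] runs over the interval. Jensen is
    applied to each of the two distances. *)
Lemma average_dist_split f (a b x : R) : in_Lp p f -> (a < b)%R ->
  (`| (b - a)^-1 * fine (\int[mu]_(u in `[a, b]) (f u)%:E) - f x |)%:E <=
  (((b - a)^-1)%:E * \int[mu]_(u in `[a, b]) (`|f (u + (x - a)) - f u| `^ p)%:E) `^ p^-1
  + (((b - a)^-1)%:E * \int[mu]_(s in `[0%R, (b - a)%R])
      (`|f (s + x) - f x| `^ p)%:E) `^ p^-1.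
Proof.
move=> Lf ab; have [mf foo] := Lf.
have ba0 : (0 < (b - a)^-1)%R by rewrite invr_gt0 subr_gt0.
have mF : measurable_fun [set: R] (fun u => f (u + (x - a)) - f u)%R
  by exact: measurable_diff.
have mG : measurable_fun [set: R] (fun u => f (u + (x - a)) - f x)%R.
  by apply: measurable_funB => //; exact: measurable_translation.
apply: (le_trans (average_dist _ ab (in_Lp_itv_integrable Lf ab))).
have mn (h : R -> R) : measurable_fun [set: R] h ->
  measurable_fun [set: R] (fun u => `|h u|)%R.
  by move=> mh; exact: measurableT_comp.
apply: (@le_trans _ _ (((b - a)^-1)%:E * \int[mu]_(u in `[a, b])
  (`|f (u + (x - a)) - f u|)%:E
  + ((b - a)^-1)%:E * \int[mu]_(u in `[a, b]) (`|f (u + (x - a)) - f x|)%:E)).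
  rewrite -ge0_muleDr; do ?by apply: integral_ge0 => u _; rewrite lee_fin.
  rewrite lee_pmul2l ?lte_fin// -ge0_integralD//.
  - apply: ge0_le_integral => //.
    + apply/measurable_EFinP; apply: measurable_funTS; apply: mn;
        exact: measurable_funB.
    + by apply: emeasurable_funD; apply/measurable_EFinP; apply: measurable_funTS;
        exact: mn.
    + move=> u _; rewrite -EFinD lee_fin (distrC (f (u + (x - a))%R)).
      by rewrite (le_trans _ (ler_normD _ _))// subrKA.
  - by apply/measurable_EFinP; apply: measurable_funTS; exact: mn.
  - by apply/measurable_EFinP; apply: measurable_funTS; exact: mn.
apply: leeD.
  exact: (@average_jensen_powR R p a b (fun u => `|f (u + (x - a)) - f u|)%R
    p1 ab (mn _ mF) (fun=> normr_ge0 _)).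
(* Substitution [u = s + a]. *)
have -> : \int[mu]_(s in `[0%R, (b - a)%R]) (`|f (s + x) - f x| `^ p)%:E =
    \int[mu]_(u in `[a, b]) (`|f (u + (x - a)) - f x| `^ p)%:E.
  rewrite integral_indicM [RHS]integral_indicM.
  rewrite -[RHS](@ge0_integral_translation R a).
  - apply: eq_integral => u _; congr (_ * _)%:E.
      rewrite !indicE; congr (nat_of_bool _)%:R; apply/idP/idP;
        rewrite !inE/= !in_itv/=;
        by rewrite lerDr lerBrDr.
    by rewrite -(addrA u) subrKC.
  - apply/measurable_EFinP/measurable_funM => //.
    exact: (measurable_normr_powR mG).
  - by move=> u; rewrite lee_fin mulr_ge0// powR_ge0.
exact: (@average_jensen_powR R p a b (fun u => `|f (u + (x - a)) - f x|)%R
  p1 ab (mn _ mG) (fun=> normr_ge0 _)).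
Qed.

End Lp.

(** * Sampling sequences *)

Section param.
Context {R : realType}.
Variables (D : set R) (mD : measurable D) (h : R * R -> R).
Hypotheses (mh : measurable_fun [set: R * R] h) (h0 : forall z, (0 <= h z)%R).

(** The restriction to [D] is carried by an indicator, so that Tonelli applies on the product of two
    full lines. *)
Let H (z : measurableTypeR R * measurableTypeR R) : \bar R := (\1_D z.2 * h z)%:E.

Let mH : measurable_fun setT H.
Proof.
apply/measurable_EFinP/measurable_funM => //.
exact: (measurableT_comp (measurable_indic mD) measurable_snd).
Qed.

Let H0 z : 0 <= H z.
Proof. by rewrite lee_fin mulr_ge0. Qed.

Lemma measurable_integral_param :
  measurable_fun [set: R] (fun y => \int[mu]_(u in D) (h (y, u))%:E).
Proof.
under eq_fun do rewrite integral_indicM.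
exact: (measurable_fun_fubini_tonelli_F H mH H0 (m2 := @mu R)).
Qed.

Lemma tonelli_param : \int[mu]_y \int[mu]_(u in D) (h (y, u))%:E =
  \int[mu]_(u in D) \int[mu]_y (h (y, u))%:E.
Proof.
under eq_integral do rewrite integral_indicM.
have := @fubini_tonelli _ _ _ _ _ (@mu R) (@mu R) H mH H0.
rewrite /H/= => ->; rewrite [RHS]integral_mkcond; apply: eq_integral => u _.
rewrite /patch indicE; case: ifPn => _.
  by under eq_integral do rewrite mul1r.
by under eq_integral do rewrite mul0r; rewrite integral0.
Qed.

End param.

Section sampling.
Context {R : realType}.
Variables (t : int -> R) (delta Delta : R).
Hypothesis st : sampling_sequence t delta Delta.

Let delta0 : (0 < delta)%R. Proof. by case: st. Qed.

(** Induction on [k - (j + 1)]. The first part keeps distinct cells from overlapping; the second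
    separates the sampling points by [delta]. *)
Lemma sampling_sequence_lt (j k : int) : (j < k)%R ->
  (t (j + 1) <= t k /\ t j + delta <= t k)%R.
Proof.
move=> jk; have [_ _ tS tD] := st.
have -> : k = (j + 1 + (absz (k - (j + 1))%R)%:Z)%R.
  by rewrite gez0_abs ?subrKC// subr_ge0 lezD1.
have dj : (t j + delta <= t (j + 1))%R by have /andP[] := tD j; rewrite lerBrDl.
elim: (absz (k - (j + 1))%R) => [|n [IH1 IH2]]; first by rewrite addr0.
have {}tS := tS (j + 1 + n%:Z)%R.
rewrite (_ : (j + 1 + n.+1%:Z = j + 1 + n%:Z + 1)%R);
  last by rewrite -addn1 PoszD addrA.
by split; [exact: le_trans IH1 (ltW tS)|exact: le_trans IH2 (ltW tS)].
Qed.

Lemma nneseries_integral_cell (w : R) (g : R -> R) : (0 < w)%R ->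
  measurable_fun [set: R] g -> (forall x, 0 <= g x)%R ->
  \sum_(n <oo) \int[mu]_(u in cell_of t w (int_of_nat n)) (g u)%:E <=
  \int[mu]_u (g u)%:E.
Proof.
move=> w0 mg g0.
pose F n : set R := `[(t (int_of_nat n) / w)%R, (t (int_of_nat n + 1) / w)%R[%classic.
under eq_eseriesr => n _.
  (* Dropping the right endpoint leaves the integral unchanged and makes the cells disjoint. *)
  rewrite /cell_of -integral_itv_bndo_bndc; last first.
    by apply/measurable_EFinP; exact: measurable_funTS.
  over.
rewrite -(@ge0_integral_bigcup _ _ _ (@mu R) F (fun u => (g u)%:E)).
- apply: ge0_subset_integral => //; last by move=> u _; rewrite lee_fin.
  + by apply: bigcup_measurable => n _; exact: measurable_itv.
  + exact/measurable_EFinP.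
- by move=> n; exact: measurable_itv.
- by apply/measurable_EFinP; exact: measurable_funTS.
- by move=> x _; rewrite lee_fin.
have F0 m n u : F m u -> F n u -> ~ (int_of_nat m < int_of_nat n)%R.
  rewrite /F/= !in_itv/= => /andP[_ um] /andP[nu _] /sampling_sequence_lt[+ _].
  rewrite -(ler_pM2r (_ : 0 < w^-1)%R) ?invr_gt0// => /(lt_le_trans um).
  by move=> /lt_le_trans/(_ nu); rewrite ltxx.
apply/trivIsetP => m n _ _ mn; apply/seteqP; split => // u [um un].
have [] := ltgtP (int_of_nat m) (int_of_nat n).
- exact: F0 um un.
- exact: F0 un um.
- have [_ inj _] := int_of_nat_bij.
  by move=> /(inj _ _ (in_setT _) (in_setT _))/eqP; rewrite (negbTE mn).
Qed.

(** The point is that the supremum defining [m0] is finite, so that [fine] keeps its value. Terms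
    with [|v - t k| >= e] are at most [e^(-b)] times those of (L2); at most one index has
    [|v - t k| < e], and there [L] is locally bounded. *)
Lemma m0_ub (L : R -> R) : (forall x, 0 <= L x)%R ->
  (exists2 r : R, 0 < r & exists M : R, forall x : R, `|x| < r -> L x <= M)%R ->
  (exists2 beta0 : R, (0 < beta0)%R & exists B : R, forall u : R,
     \esum_(k in [set: int]) (L (u - t k) * `|u - t k| `^ beta0)%:E <= B%:E) ->
  forall u, \sum_(n <oo) (L (u - t (int_of_nat n)))%:E <= (m0 t L)%:E.
Proof.
move=> L0 [r r0 [M LM]] [b b0 [B LB]] u.
(* Below [r] the bound [M] applies; below [delta / 2] no two sampling points can both be that close
   to [v]. *)
pose e := Num.min r (delta / 2)%R.
have e0 : (0 < e)%R by rewrite lt_min r0 divr_gt0.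
have eb0 : (0 < e `^ b)%R by exact: powR_gt0.
have ub v : \esum_(k in [set: int]) (L (v - t k))%:E <=
  ((e `^ b)^-1 * B + Num.max M 0)%:E.
  have h : \esum_(k in [set: int]) (L (v - t k))%:E <=
    \esum_(k in [set: int]) ((((e `^ b)^-1 * (L (v - t k) * `|v - t k| `^ b))%:E)
      + (if (`|v - t k| < e)%R then Num.max M 0 else 0%R)%:E).
    apply: le_esum => k _; rewrite -EFinD lee_fin.
    have [ek|ek] := ltP `|v - t k|%R e.
      have /LM Lk : (`|v - t k| < r)%R by rewrite (lt_le_trans ek)// ge_min lexx.
      rewrite ler_wpDl ?le_max ?Lk// mulr_ge0 ?invr_ge0 ?(ltW eb0)//.
      by rewrite mulr_ge0// powR_ge0.
    rewrite addr0 mulrC -mulrA ler_peMr// ler_pdivlMr// mul1r.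
    by apply: ge0_ler_powR => //; rewrite ?nnegrE ?(ltW b0)// ltW.
  apply: (le_trans h); rewrite esumD; last 2 first.
  - move=> k _; rewrite lee_fin mulr_ge0 ?invr_ge0 ?(ltW eb0)//.
    by rewrite mulr_ge0// powR_ge0.
  - by move=> k _; case: ifPn => _; rewrite lee_fin// le_max lexx orbT.
  rewrite EFinD; apply: leeD.
    have Lb0 k : 0 <= (L (v - t k) * `|v - t k| `^ b)%:E
      by rewrite lee_fin mulr_ge0// powR_ge0.
    rewrite esum_int_nneseries; last first.
      by move=> k; rewrite EFinM mule_ge0// lee_fin invr_ge0 ltW.
    under eq_eseriesr do rewrite EFinM.
    rewrite nneseriesZl; last by move=> n _; exact: Lb0.
    rewrite EFinM lee_pmul2l ?lte_fin ?invr_gt0//.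
    by rewrite -(esum_int_nneseries Lb0).
  have [[k0 k0e]|nok] := pselect (exists k, `|v - t k| < e)%R; last first.
    rewrite esum1 ?lee_fin ?le_max ?lexx ?orbT// => k _.
    by case: ifPn => // ke; exfalso; apply: nok; exists k.
  have far j k : (`|v - t j| < e)%R -> (`|v - t k| < e)%R -> ~ (j < k)%R.
    move=> + + /sampling_sequence_lt[_]; rewrite !lt_min => /andP[_ +] /andP[_ +].
    by rewrite !ltr_norml => /andP[? ?] /andP[? ?] ?; lra.
  apply: (@le_trans _ _ (\esum_(k in [set: int]) (if k \in [set k0] then (Num.max M 0)%:E else 0))).
    apply: le_esum => k _; case: ifPn => [ke|_]; last first.
      by case: ifPn => // _; rewrite lee_fin le_max lexx orbT.
    have [/(far _ _ ke k0e)//|/(far _ _ k0e ke)//|->] := ltgtP k k0.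
    by rewrite mem_set.
  rewrite -(esum_mkcondr _ [set k0] (fun=> (Num.max M 0)%:E)) setTI esum_set1//.
  by rewrite lee_fin le_max lexx orbT.
rewrite -(@esum_int_nneseries _ (fun k => (L (u - t k))%:E)); last by move=> k;
  rewrite lee_fin.
set S := fun v => \esum_(k in [set: int]) (L (v - t k))%:E.
have Su : S u <= ereal_sup (range S) by apply: ereal_sup_ubound; exists u.
apply: (le_trans Su); rewrite /m0 fineK// ge0_fin_numE.
  by apply: (@le_lt_trans _ _ ((e `^ b)^-1 * B + Num.max M 0)%:E); rewrite ?ltry//;
    apply: ge_ereal_sup => _ [v _ <-]; exact: ub.
by apply: le_trans Su; apply: esum_ge0 => k _; rewrite lee_fin.
Qed.

Lemma m0_ge0 (L : R -> R) : (forall x, 0 <= L x)%R -> (0 <= m0 t L)%R.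
Proof.
move=> L0; apply/fine_ge0/(le_trans _ (ereal_sup_ubound _)); last by exists 0%R.
by apply: esum_ge0 => k _; rewrite lee_fin.
Qed.

End sampling.

(** * The two majorants *)

(** Convexity of the [p]-th power at the midpoint of [1] and [z]. *)
Lemma powR_add1_le (R : realType) (p z : R) : (1 <= p)%R -> (0 <= z)%R ->
  ((1 + z) `^ p <= 2 `^ (p - 1) * (1 + z `^ p))%R.
Proof.
move=> p1 z0; have p0 : (0 < p)%R by exact: lt_le_trans p1.
have h : ((2^-1 * 1 + 2^-1 * z) `^ p <= 2^-1 * 1 `^ p + 2^-1 * z `^ p)%R.
  rewrite {2 4}(_ : 2^-1 = 1 - 2^-1)%R; last by rewrite {2}(splitr 1) div1r addrK.
  by apply: (convex_powR p1 (Itv01 _ _)) => //=;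
    rewrite ?inE/= ?in_itv/= ?z0 ?ler01// ?invr_ge0// invf_le1 ?ler1n.
have -> : (1 + z = 2 * (2^-1 * 1 + 2^-1 * z))%R by field.
rewrite powRM//; last by rewrite addr_ge0// mulr_ge0.
rewrite -(@mulr_powRB1 _ 2 p)// mulrAC mulrC ler_pM2l ?powR_gt0//.
by apply: (le_trans (ler_wpM2l _ h)) => //; rewrite powR1; lra.
Qed.

Section kernel_moment.
Context {R : realType} (p : R) (L : R -> R).
Hypotheses (p1 : (1 <= p)%R) (mL : measurable_fun [set: R] L)
  (L0 : forall x, (0 <= L x)%R)
  (iL : mu.-integrable [set: R] (EFin \o L)) (ML : Mp p L < +oo).

Let p0 : (0 < p)%R. Proof. exact: lt_le_trans p1. Qed.

Lemma kernel_moment :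
  \int[mu]_z (L z * (1 + `|z|) `^ p)%:E <= (2 `^ (p - 1) * (normL1 L + fine (Mp p L)))%:E.
Proof.
have mp : measurable_fun [set: R] (fun z : R => `|z| `^ p)%R
  by exact: measurable_normr_powR.
have mp' : measurable_fun [set: R] (fun z : R => (1 + `|z|) `^ p)%R.
  apply: (@measurableT_comp _ _ _ _ _ _ (@powR R ^~ p)) => //.
  by apply: measurable_funD => //; exact: measurableT_comp.
have Mp0 : 0 <= Mp p L.
  by apply: integral_ge0 => z _; rewrite lee_fin mulr_ge0// powR_ge0.
apply: (@le_trans _ _ (\int[mu]_z ((2 `^ (p - 1))%:E * ((`|L z|)%:E + (L z * `|z| `^ p)%:E)))).
  apply: ge0_le_integral => //.
  - by move=> z _; rewrite lee_fin mulr_ge0// powR_ge0.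
  - by apply/measurable_EFinP; exact: measurable_funM.
  - apply: (emeasurable_funM (measurable_cst _)); apply: emeasurable_funD;
      apply/measurable_EFinP.
      exact: measurableT_comp.
    exact: measurable_funM.
  - move=> z _; rewrite -EFinD -EFinM lee_fin (ger0_norm (L0 z)).
    have := ler_wpM2l (L0 z) (powR_add1_le p1 (normr_ge0 z)).
    by move/le_trans; apply; rewrite le_eqVlt; apply/orP; left; apply/eqP; ring.
have mLn : measurable_fun [set: R] (fun z => (`|L z|)%:E).
  by apply/measurable_EFinP; exact: measurableT_comp.
have mLp : measurable_fun [set: R] (fun z => (L z * `|z| `^ p)%:E).
  by apply/measurable_EFinP; exact: measurable_funM.
have Lp0 z : [set: R] z -> 0 <= (L z * `|z| `^ p)%:E
  by rewrite lee_fin mulr_ge0// powR_ge0.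
rewrite ge0_integralZl_EFin//; last 2 first.
- by move=> z _; rewrite adde_ge0// lee_fin mulr_ge0 ?powR_ge0.
- exact: emeasurable_funD.
rewrite ge0_integralD//.
have iLn : \int[mu]_z (`|L z|)%:E < +oo by have /integrableP[] := iL.
rewrite EFinM EFinD /normL1 !fineK//.
- by rewrite ge0_fin_numE.
- by rewrite ge0_fin_numE//; apply: integral_ge0 => z _; rewrite lee_fin.
Qed.

End kernel_moment.

Section majorants.
Context {R : realType}.
Variables (p : R) (t : int -> R) (delta Delta : R) (L : R -> R) (f : R -> R) (w : R).
Hypotheses (p1 : (1 <= p)%R) (st : sampling_sequence t delta Delta)
  (mL : measurable_fun [set: R] L) (L0 : forall x, (0 <= L x)%R)
  (Lf : in_Lp p f) (w0 : (0 < w)%R).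

Let p0 : (0 < p)%R. Proof. exact: lt_le_trans p1. Qed.
Let mf : measurable_fun [set: R] f. Proof. by case: Lf. Qed.
Let foo : Lpnorm p f < +oo. Proof. by case: Lf. Qed.
Let delta0 : (0 < delta)%R. Proof. by case: st. Qed.
Let Delta0 : (0 < Delta)%R. Proof. by case: st => d0 dD _ _; exact: lt_le_trans dD. Qed.
Let wd0 : (0 < w / delta)%R. Proof. exact: divr_gt0. Qed.

Definition cell_left n := (t (int_of_nat n) / w)%R.
Definition cell_right n := (t (int_of_nat n + 1) / w)%R.
Definition cell_weight n := ((cell_right n - cell_left n)^-1)%R.

Definition cell_modulus n (y : R) : \bar R :=
  \int[mu]_(u in `[cell_left n, cell_right n]) (`|f (u + y) - f u| `^ p)%:E.

(** The function [J1] of the overview; [A_k(x)] is the factor made of [cell_weight] and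
    [cell_modulus], the latter taken at the shift [x - t_k/w]. *)
Definition kernel_modulus (x : R) : \bar R :=
  \sum_(n <oo) (L (w * x - t (int_of_nat n)))%:E *
    ((cell_weight n)%:E * cell_modulus n (x - cell_left n)).

(** The function [B] of the overview. Its constants [w / delta] and [Delta / w] bound the weight and
    the length of every cell, which makes it independent of [k]. *)
Definition local_modulus (x : R) : \bar R :=
  (w / delta)%:E * \int[mu]_(s in `[0%R, (Delta / w)%R]) (`|f (s + x) - f x| `^ p)%:E.

Lemma cell_lt n : (cell_left n < cell_right n)%R.
Proof. by rewrite ltr_pM2r ?invr_gt0//; case: st. Qed.

Lemma cell_weight_gt0 n : (0 < cell_weight n)%R.
Proof. by rewrite invr_gt0 subr_gt0 cell_lt. Qed.

Lemma cell_weight_le n : (cell_weight n <= w / delta)%R.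
Proof.
have [_ _ _ /(_ (int_of_nat n))/andP[d _]] := st.
rewrite -[leRHS]invrK invf_div lef_pV2 ?posrE ?divr_gt0 ?subr_gt0 ?cell_lt//.
by rewrite /cell_right /cell_left -mulrBl ler_pM2r ?invr_gt0.
Qed.

Lemma cell_length_le n : (cell_right n - cell_left n <= Delta / w)%R.
Proof.
have [_ _ _ /(_ (int_of_nat n))/andP[_ d]] := st.
by rewrite /cell_right /cell_left -mulrBl ler_pM2r ?invr_gt0.
Qed.

Lemma Lpnorm_fin_num : Lpnorm p f \is a fin_num.
Proof. by rewrite ge0_fin_numE// Lpnorm_ge0. Qed.

Lemma omega_p_fin_num d : (0 <= d)%R -> omega_p p f d \is a fin_num.
Proof.
move=> d0; rewrite ge0_fin_numE ?omega_p_ge0//.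
apply: (le_lt_trans (omega_p_le p1 _ mf)).
by rewrite -(fineK Lpnorm_fin_num) -EFinM ltry.
Qed.

Lemma measurable_diff_powR : measurable_fun [set: R * R]
  (fun z : R * R => `|f (z.2 + z.1) - f z.2| `^ p)%R.
Proof.
apply: (@measurableT_comp _ _ _ _ _ _ (@powR R ^~ p)) => //.
apply: measurableT_comp => //; apply: measurable_funB.
  by apply: (measurableT_comp mf); apply: measurable_funD;
    [exact: measurable_snd|exact: measurable_fst].
exact: (measurableT_comp mf measurable_snd).
Qed.

Lemma measurable_diff_powR' : measurable_fun [set: R * R]
  (fun z : R * R => `|f (z.2 + z.1) - f z.1| `^ p)%R.
Proof.
apply: (@measurableT_comp _ _ _ _ _ _ (@powR R ^~ p)) => //.
apply: measurableT_comp => //; apply: measurable_funB.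
  by apply: (measurableT_comp mf); apply: measurable_funD;
    [exact: measurable_snd|exact: measurable_fst].
exact: (measurableT_comp mf measurable_fst).
Qed.

Lemma cell_modulus_ge0 n y : 0 <= cell_modulus n y.
Proof. by apply: integral_ge0 => u _; rewrite lee_fin powR_ge0. Qed.

Lemma measurable_cell_modulus n : measurable_fun [set: R] (cell_modulus n).
Proof.
apply: (measurable_integral_param (measurable_itv _) measurable_diff_powR).
by move=> z; rewrite powR_ge0.
Qed.

Lemma Lpnorm_diff_powR y :
  \int[mu]_u (`|f (u + y) - f u| `^ p)%:E = Lpnorm p (fun x => f (x + y) - f x)%R `^ p.
Proof. by rewrite Lpnorm_powR. Qed.

Lemma sum_cell_modulus_le y : \sum_(n <oo) cell_modulus n y <=
  Lpnorm p (fun x => f (x + y) - f x)%R `^ p.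
Proof.
rewrite -Lpnorm_diff_powR.
apply: (nneseries_integral_cell st w0 (g := fun u => (`|f (u + y) - f u| `^ p)%R)).
  by apply: measurable_normr_powR; exact: measurable_diff.
by move=> u; rewrite powR_ge0.
Qed.

Lemma lee_poweR (a b : \bar R) : 0 <= a -> a <= b -> a `^ p <= b `^ p.
Proof.
move=> a0 ab; apply: gt0_ler_poweR => //; first exact: ltW.
  by rewrite in_itv/= leey andbT.
by rewrite in_itv/= leey andbT (le_trans a0).
Qed.

Lemma cell_modulus_le n y : cell_modulus n y <= ((2 * fine (Lpnorm p f)) `^ p)%:E.
Proof.
apply: (@le_trans _ _ (Lpnorm p (fun x => f (x + y) - f x)%R `^ p)).
  rewrite -Lpnorm_diff_powR; apply: ge0_subset_integral => //.
    by apply/measurable_EFinP; apply: measurable_normr_powR; exact: measurable_diff.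
rewrite -poweR_EFin; apply: lee_poweR; first exact: Lpnorm_ge0.
by rewrite EFinM fineK ?Lpnorm_fin_num//; exact: Lpnorm_diff_le.
Qed.

(** The cell moduli are bounded uniformly in [n] and the weights have sum at most [m]. Finiteness at
    every point allows [fine] in the real-valued majorant. *)
Lemma kernel_modulus_lty (m : R) x :
  (forall u, \sum_(n <oo) (L (u - t (int_of_nat n)))%:E <= m%:E) ->
  kernel_modulus x < +oo.
Proof.
move=> hm; pose K := (w / delta * (2 * fine (Lpnorm p f)) `^ p)%R.
have K0 : (0 <= K)%R by rewrite mulr_ge0 ?powR_ge0 ?(ltW wd0).
apply: (@le_lt_trans _ _ (K%:E * m%:E)); last by rewrite -EFinM ltry.
apply: (@le_trans _ _ (\sum_(n <oo) K%:E * (L (w * x - t (int_of_nat n)))%:E)).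
  apply: lee_nneseries => [n _ _|n _].
    by rewrite !mule_ge0 ?lee_fin ?cell_modulus_ge0// ltW// cell_weight_gt0.
  rewrite muleC lee_pmul ?lee_fin//.
    by rewrite mule_ge0 ?cell_modulus_ge0// lee_fin ltW// cell_weight_gt0.
  rewrite /K EFinM; apply: lee_pmul; rewrite ?lee_fin ?cell_modulus_ge0
    ?cell_weight_le ?cell_modulus_le//.
  by rewrite ltW// cell_weight_gt0.
rewrite nneseriesZl; last by move=> n _; rewrite lee_fin.
by apply: lee_wpmul2l; rewrite ?lee_fin.
Qed.

Lemma kernel_modulus_ge0 x : 0 <= kernel_modulus x.
Proof.
apply: nneseries_ge0 => n _ _.
by rewrite !mule_ge0 ?lee_fin ?cell_modulus_ge0// ltW// cell_weight_gt0.
Qed.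

(** The [n]-th term of [kernel_modulus] in the variable [y = x - cell_left n], for which
    [L (w * x - t_k)] becomes [L (w * y)]. *)
Let G n (y : R) : \bar R := (L (w * y))%:E * ((cell_weight n)%:E * cell_modulus n y).

Let G0 n y : 0 <= G n y.
Proof. by rewrite !mule_ge0 ?lee_fin ?cell_modulus_ge0// ltW// cell_weight_gt0. Qed.

Let mLw : measurable_fun [set: R] (fun y => (L (w * y))%:E).
Proof. by apply/measurable_EFinP; apply: (measurableT_comp mL);
  exact: measurable_funM. Qed.

Let mG n : measurable_fun [set: R] (G n).
Proof.
apply: emeasurable_funM; first exact: mLw.
by apply: emeasurable_funM => //; exact: measurable_cell_modulus.
Qed.

Let kernel_modulusE x : kernel_modulus x = \sum_(n <oo) G n (x - cell_left n).
Proof.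
apply: eq_eseriesr => n _; congr ((L _)%:E * _).
by rewrite mulrBr /cell_left mulrCA divff ?mulr1// gt_eqF.
Qed.

Let mGT n : measurable_fun [set: R] (fun x => G n (x - cell_left n)).
Proof. by apply: (measurableT_comp (mG n)); exact: measurable_funB. Qed.

Lemma measurable_kernel_modulus : measurable_fun [set: R] kernel_modulus.
Proof.
rewrite (funext kernel_modulusE).
by apply: ge0_emeasurable_sum => // n x _ _; exact: G0.
Qed.

Lemma integral_kernel_modulus_le :
  mu.-integrable [set: R] (EFin \o L) -> Mp p L < +oo ->
  \int[mu]_x kernel_modulus x <=
  (delta^-1 * (2 `^ (p - 1) * (normL1 L + fine (Mp p L)))
   * fine (omega_p p f w^-1) `^ p)%:E.
Proof.
move=> iL ML; set om := fine (omega_p p f w^-1).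
have w10 : (0 <= w^-1)%R by rewrite invr_ge0 ltW.
have om0 : (0 <= om)%R by rewrite fine_ge0// omega_p_ge0.
under eq_integral do rewrite kernel_modulusE.
rewrite integral_nneseries//.
(* Translation invariance removes the shift from each term; the series then returns under the
   integral, with one kernel factor common to all cells. *)
under eq_eseriesr => n _.
  rewrite (@ge0_integral_translation R (- cell_left n) (G n))//.
  over.
have <- : \int[mu]_y (\sum_(n <oo) G n y) = \sum_(n <oo) \int[mu]_y G n y.
  exact: (@integral_nneseries _ _ _ (@mu R) setT measurableT G mG
    (fun n x _ => G0 n x)).
have mD : measurable_fun [set: R] (fun y : R => (1 + `|w * y|) `^ p)%R.
  apply: (@measurableT_comp _ _ _ _ _ _ (@powR R ^~ p)) => //.
  by apply: measurable_funD => //; apply: measurableT_comp => //;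
    exact: measurable_funM.
apply: (@le_trans _ _ (\int[mu]_y ((w / delta * om `^ p)%:E * (L (w * y) * (1 + `|w * y|) `^ p)%:E))).
  apply: ge0_le_integral => //.
  - by move=> y _; apply: nneseries_ge0.
  - by apply: ge0_emeasurable_sum => // n _; exact: mG.
  - apply: emeasurable_funM => //; apply/measurable_EFinP/measurable_funM;
      last exact: mD.
    exact/measurable_EFinP.
  - move=> y _.
    (* The uniform bound [w / delta] on the cell weights leaves only the cell moduli inside the
       sum. *)
    apply: (@le_trans _ _ (\sum_(n <oo) ((L (w * y) * (w / delta))%:E * cell_modulus n y))).
      apply: lee_nneseries => // n _.
      rewrite /G muleA -EFinM; apply: lee_wpmul2r; first exact: cell_modulus_ge0.
      by rewrite lee_fin ler_wpM2l// cell_weight_le.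
    rewrite nneseriesZl; last by move=> n _; exact: cell_modulus_ge0.
    have -> : (w / delta * om `^ p)%:E * (L (w * y) * (1 + `|w * y|) `^ p)%:E =
      (L (w * y) * (w / delta))%:E * ((1 + `|w * y|) * om)%:E `^ p.
      rewrite poweR_EFin powRM// ?addr_ge0// -!EFinM; congr EFin; ring.
    apply: lee_wpmul2l; first by rewrite lee_fin mulr_ge0// ltW.
    apply: (le_trans (sum_cell_modulus_le y)).
    apply: lee_poweR; first exact: Lpnorm_ge0.
    rewrite EFinM fineK ?omega_p_fin_num// mulrC normrM (ger0_norm (ltW w0)).
    have := @Lpnorm_diff_omega _ _ p1 f y (w^-1)%R mf.
    by rewrite invrK invr_gt0 => /(_ w0).
rewrite ge0_integralZl_EFin//; last 3 first.
- by move=> y _; rewrite lee_fin mulr_ge0// powR_ge0.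
- by apply/measurable_EFinP/measurable_funM; [exact/measurable_EFinP|exact: mD].
- by rewrite mulr_ge0 ?powR_ge0// ltW.
(* The factor [w] is set apart for the substitution [z = w y]. *)
have -> : (w / delta * om `^ p)%:E = (delta^-1 * om `^ p)%:E * w%:E.
  by rewrite -EFinM; congr EFin; ring.
rewrite -muleA.
have -> : w%:E * \int[mu]_y (L (w * y) * (1 + `|w * y|) `^ p)%:E =
    \int[mu]_z (L z * (1 + `|z|) `^ p)%:E.
  pose h (z : R) : \bar R := (L z * (1 + `|z|) `^ p)%:E.
  have mh : measurable_fun [set: R] h.
    apply/measurable_EFinP/measurable_funM => //.
    apply: (@measurableT_comp _ _ _ _ _ _ (@powR R ^~ p)) => //.
    by apply: measurable_funD => //; exact: measurableT_comp.
  have h0 z : 0 <= h z by rewrite lee_fin mulr_ge0// powR_ge0.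
  have hw y : (L (w * y) * (1 + `|w * y|) `^ p)%:E = h (w * y + 0)%R by rewrite addr0.
  by under eq_integral do rewrite hw; exact: ge0_integral_affine.
rewrite [in leRHS]mulrAC [leRHS]EFinM; apply: lee_wpmul2l.
  by rewrite lee_fin mulr_ge0 ?powR_ge0// invr_ge0 ltW.
exact: kernel_moment.
Qed.

Lemma local_modulus_ge0 x : 0 <= local_modulus x.
Proof.
apply: mule_ge0; first by rewrite lee_fin ltW.
by apply: integral_ge0 => s _; rewrite lee_fin powR_ge0.
Qed.

Lemma measurable_local_modulus : measurable_fun [set: R] local_modulus.
Proof.
apply: emeasurable_funM => //.
apply: (measurable_integral_param (measurable_itv _) measurable_diff_powR').
by move=> z; rewrite powR_ge0.
Qed.

Lemma integral_local_modulus_le :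
  \int[mu]_x local_modulus x <= (delta^-1 * Delta * fine (omega_p p f (Delta / w)) `^ p)%:E.
Proof.
have Dw0 : (0 < Delta / w)%R by exact: divr_gt0.
set om := fine (omega_p p f (Delta / w)).
rewrite ge0_integralZl_EFin//; last 3 first.
- by move=> x _; apply: integral_ge0 => s _; rewrite lee_fin powR_ge0.
- apply: (measurable_integral_param (measurable_itv _) measurable_diff_powR').
  by move=> z; rewrite powR_ge0.
- exact: ltW.
rewrite (tonelli_param (measurable_itv `[0%R, (Delta / w)%R]) measurable_diff_powR');
  last first.
  by move=> z; rewrite powR_ge0.
(* After Tonelli the integrand is at most [om^p] on an interval of length [Delta / w]. *)
have -> : (delta^-1 * Delta * om `^ p)%:E = (w / delta)%:E * ((om `^ p)%:E * (Delta / w)%:E).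
  by rewrite -!EFinM; congr EFin; field; rewrite !gt_eqF.
apply: lee_wpmul2l; first by rewrite lee_fin ltW.
have -> : (om `^ p)%:E * (Delta / w)%:E = \int[mu]_(s in `[0%R, (Delta / w)%R]) (cst (om `^ p)%:E s).
  by rewrite integral_cst//= lebesgue_measure_itv/= lte_fin Dw0 sube0.
apply: ge0_le_integral => //.
- by move=> s _; apply: integral_ge0 => x _; rewrite lee_fin powR_ge0.
- apply: measurable_funTS.
  apply: (measurable_integral_param measurableT (h := fun z =>
    (`|f (z.1 + z.2) - f z.2| `^ p)%R)).
    rewrite [X in measurable_fun _ X](_ : _ = fun z => `|f (z.2 + z.1) - f z.2| `^ p)%R.
      exact: measurable_diff_powR.
    by apply/funext => z; rewrite (addrC z.1).
  by move=> z; rewrite powR_ge0.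
- move=> s; rewrite /= in_itv/= => /andP[s0 sD].
  have -> : \int[mu]_y (`|f (s + y) - f y| `^ p)%:E =
    \int[mu]_y (`|f (y + s) - f y| `^ p)%:E.
    by apply: eq_integral => y _; rewrite (addrC s).
  rewrite Lpnorm_diff_powR -poweR_EFin; apply: lee_poweR; first exact: Lpnorm_ge0.
  rewrite fineK; last exact/omega_p_fin_num/ltW.
  by apply: omega_p_ge; rewrite ger0_norm.
Qed.

(** Finite at every [x], not only almost everywhere: by Minkowski it suffices to bound the norms of
    a translate of [f] and of the constant [f x] cut off to a bounded interval. *)
Lemma local_modulus_lty x : local_modulus x < +oo.
Proof.
set D := `[0%R, (Delta / w)%R]%classic : set R.
have Dw0 : (0 < Delta / w)%R by exact: divr_gt0.
have mD : measurable_fun [set: R] (\1_D : R -> R).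
  exact: (measurable_indic (measurable_itv _)).
pose g s : R := (\1_D s * (f (s + x) - f x))%R.
have mg : measurable_fun [set: R] g.
  apply: measurable_funM => //; apply: measurable_funB => //.
  exact: measurable_translation.
rewrite /local_modulus; apply: lte_mul_pinfty; rewrite ?lee_fin ?(ltW wd0)//.
have -> : \int[mu]_(s in D) (`|f (s + x) - f x| `^ p)%:E = Lpnorm p g `^ p.
  rewrite (Lpnorm_powR p1 g).
  apply: (etrans (integral_indicM D (fun s => `|f (s + x) - f x| `^ p)%R)).
  apply: eq_integral => s _.
  rewrite /g indicE; case: (s \in D); rewrite ?mul1r//.
  by rewrite !mul0r normr0 powR0// gt_eqF.
apply: poweR_lty.
apply: (@le_lt_trans _ _ (Lpnorm p (fun s => `|f (s + x)| + `|f x| * \1_D s)%R)).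
  apply: le_Lpnorm => // s; rewrite /g indicE; case: (s \in D).
    by rewrite mul1r mulr1 ler_normB.
  by rewrite mul0r normr0 mulr0 addr0.
apply: (le_lt_trans (@LpnormD _ p p1 (fun s => `|f (s + x)|)%R
  (fun s => `|f x| * \1_D s)%R _ _)).
- by apply: measurableT_comp => //; exact: measurable_translation.
- exact: measurable_funM.
apply: lte_add_pinfty.
  apply: (@le_lt_trans _ _ (Lpnorm p (fun s => f (s + x))%R));
    last by rewrite Lpnorm_translation.
  by rewrite !LpnormE; under eq_integral do rewrite normr_id.
rewrite LpnormZ//; apply: lte_mul_pinfty => //.
rewrite LpnormE; apply: poweR_lty.
have -> : \int[mu]_s (`|\1_D s| `^ p)%:E = \int[mu]_s (\1_D s)%:E.
  apply: eq_integral => s _; rewrite indicE; case: (s \in D).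
    by rewrite normr1 powR1.
  by rewrite normr0 powR0// gt_eqF.
have -> : \int[mu]_s (\1_D s)%:E = \int[mu]_(s in D) (@cst R R 1%R s)%:E.
  apply/esym/(etrans (integral_indicM D (cst 1%R))).
  by apply: eq_integral => s _; rewrite mulr1.
have := @integral_cst _ _ _ (@mu R) D (measurable_itv _) 1.
by rewrite /= lebesgue_measure_itv/= lte_fin Dw0 mul1e sube0 => ->; rewrite ltry.
Qed.

End majorants.

(** * Pointwise estimate *)

(** The [p]-th power in the norm cancels the root, so the norm equals the root of [c] times the
    integral of [J]. *)
Lemma Lpnorm_root_le (R : realType) (p c B : R) (J : R -> \bar R) : (1 <= p)%R ->
  (0 <= c)%R -> measurable_fun [set: R] J ->
  (forall x, 0 <= J x) -> (forall x, J x < +oo) ->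
  \int[mu]_x J x <= B%:E ->
  Lpnorm p (fun x => (c * fine (J x)) `^ p^-1)%R <= ((c * B) `^ p^-1)%:E.
Proof.
move=> p1 c0 mJ J0 Jy JB; have p0 : (0 < p)%R by exact: lt_le_trans p1.
have -> : Lpnorm p (fun x => (c * fine (J x)) `^ p^-1)%R =
  (c%:E * \int[mu]_x J x) `^ p^-1.
  rewrite LpnormE -ge0_integralZl_EFin//; congr (_ `^ _); apply: eq_integral => x _.
  rewrite ger0_norm ?powR_ge0// -powRrM mulVf ?gt_eqF// powRr1;
    last by rewrite mulr_ge0// fine_ge0.
  by rewrite EFinM fineK// ge0_fin_numE.
have I0 : 0 <= \int[mu]_x J x by exact: integral_ge0.
rewrite -poweR_EFin; apply: gt0_ler_poweR; first by rewrite invr_ge0 ltW.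
- by rewrite in_itv/= leey andbT mule_ge0.
- by rewrite in_itv/= leey andbT EFinM mule_ge0//; exact: le_trans JB.
- by rewrite EFinM lee_wpmul2l.
Qed.

Section pointwise.
Context {R : realType}.
Variables (p : R) (t : int -> R) (delta Delta : R) (chi : R -> R -> R) (L : R -> R).
Variables (f : R -> R) (w m : R).
Hypotheses (p1 : (1 <= p)%R) (st : sampling_sequence t delta Delta)
  (chi1 : forall x u w : R, (0 < w)%R -> summable_Z (fun k => chi (w * x - t k)%R u))
  (L0 : forall x, (0 <= L x)%R)
  (chi3 : forall x u v, (`|chi x u - chi x v| <= L x * `|u - v|)%R)
  (hm : forall u, \sum_(n <oo) (L (u - t (int_of_nat n)))%:E <= m%:E)
  (Lf : in_Lp p f) (w0 : (0 < w)%R).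

Let p0 : (0 < p)%R. Proof. exact: lt_le_trans p1. Qed.
Let pV0 : (0 <= p^-1)%R. Proof. by rewrite invr_ge0 ltW. Qed.

Let Kn n x := (cell_weight t w n)%:E * cell_modulus p t f w n (x - cell_left t w n).
Let J1 := kernel_modulus p t L f w.
Let J2 := local_modulus p delta Delta f w.

Let average k : R := (w / (t (k + 1) - t k) *
  fine (\int[mu]_(u in cell_of t w k) (f u)%:E))%R.

Lemma le_poweR_inv (a b : \bar R) : 0 <= a -> a <= b -> a `^ p^-1 <= b `^ p^-1.
Proof.
move=> a0 ab; apply: gt0_ler_poweR => //.
  by rewrite in_itv/= leey andbT.
by rewrite in_itv/= leey andbT (le_trans a0).
Qed.

Lemma cell_average_dist n x :
  (`|average (int_of_nat n) - f x|)%:E <= (Kn n x) `^ p^-1 + (J2 x) `^ p^-1.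
Proof.
have ab := cell_lt st w0 n.
have := average_dist_split p1 x Lf ab.
have -> : ((cell_right t w n - cell_left t w n)^-1 *
    fine (\int[mu]_(u in `[cell_left t w n, cell_right t w n]) (f u)%:E) =
    average (int_of_nat n))%R.
  rewrite /average; congr (_ * _)%R.
  by rewrite /cell_right /cell_left -mulrBl invf_div.
move=> /le_trans; apply; apply: leeD => //.
have c0 := cell_weight_gt0 st w0 n.
have I0 (D : set R) : 0 <= \int[mu]_(s in D) (`|f (s + x) - f x| `^ p)%:E.
  by apply: integral_ge0 => s _; rewrite lee_fin powR_ge0.
apply: le_poweR_inv; first by rewrite mule_ge0// lee_fin ltW.
apply: lee_pmul => //; rewrite ?lee_fin ?(cell_weight_le st w0)//; first exact: ltW.
have mg : measurable_fun [set: R] (fun s => f (s + x) - f x)%R.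
  by apply: measurable_funB => //; apply: measurable_translation; case: Lf.
apply: ge0_subset_integral => //.
  apply: measurable_funTS; apply/measurable_EFinP; exact: measurable_normr_powR.
move=> s /=; rewrite !in_itv/= => /andP[-> /le_trans]; apply.
exact: (cell_length_le st w0).
Qed.

(** (chi3) brings in the weights [L (w * x - t_k)]. Jensen for series treats the part depending on
    the cell; the other part is constant in [n] and only picks up the total weight [m]. *)
Lemma esum_chi_dist x :
  \esum_(k in [set: int]) (`|chi (w * x - t k) (average k)
    - chi (w * x - t k) (f x)|)%:E <=
  ((m `^ (p - 1) * fine (J1 x)) `^ p^-1 + (m `^ p * fine (J2 x)) `^ p^-1)%:E.
Proof.
have m0 : (0 <= m)%R.
  by rewrite -lee_fin (le_trans _ (hm 0))//; apply: nneseries_ge0 => n _ _;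
    rewrite lee_fin.
have Kn0 n : 0 <= Kn n x.
  by rewrite mule_ge0 ?cell_modulus_ge0// lee_fin ltW// (cell_weight_gt0 st w0).
have Knfin n : Kn n x \is a fin_num.
  rewrite ge0_fin_numE//; apply: (@le_lt_trans _ _ ((cell_weight t w n)%:E * ((2 * fine (Lpnorm p f)) `^ p)%:E)).
    apply: lee_wpmul2l; first by rewrite lee_fin ltW// (cell_weight_gt0 st w0).
    exact: cell_modulus_le.
  by rewrite -EFinM ltry.
have J20 : 0 <= J2 x by exact: (local_modulus_ge0 p f st w0).
have J2fin : J2 x \is a fin_num.
  by rewrite ge0_fin_numE//; exact: (local_modulus_lty p1 st Lf w0).
have J1fin : J1 x \is a fin_num.
  rewrite ge0_fin_numE; last exact: (kernel_modulus_ge0 p f st L0 w0).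
  exact: (kernel_modulus_lty p1 st L0 Lf w0 _ hm).
pose v n := L (w * x - t (int_of_nat n)).
pose g n := (fine (Kn n x) `^ p^-1)%R.
pose b := (fine (J2 x) `^ p^-1)%R.
have g0 n : (0 <= g n)%R by rewrite powR_ge0.
have v0 n : (0 <= v n)%R by exact: L0.
rewrite esum_int_nneseries; last by move=> k; rewrite lee_fin.
apply: (@le_trans _ _ (\sum_(n <oo) ((v n * g n)%:E + b%:E * (v n)%:E))).
  apply: lee_nneseries => // n _.
  apply: (@le_trans _ _ ((v n)%:E * (`|average (int_of_nat n) - f x|)%:E)).
    by rewrite -EFinM lee_fin; exact: chi3.
  apply: (le_trans (lee_wpmul2l _ (cell_average_dist n x))); first by rewrite lee_fin.
  rewrite -(fineK (Knfin n)) -(fineK J2fin) !poweR_EFin -!EFinD -!EFinM lee_fin.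
  by rewrite /g /b mulrDr (mulrC _ (v n)).
rewrite nneseriesD; last 2 first.
- by move=> n _; rewrite lee_fin mulr_ge0.
- by move=> n _; rewrite -EFinM lee_fin mulr_ge0// powR_ge0.
rewrite EFinD; apply: leeD.
  apply: (le_trans (nneseries_jensen_powR p1 v0 g0 (hm (w * x)))).
  rewrite -[leRHS]poweR_EFin [in leRHS]EFinM (fineK J1fin); apply: le_poweR_inv.
    rewrite mule_ge0 ?lee_fin ?powR_ge0//; apply: nneseries_ge0 => n _ _.
    by rewrite lee_fin mulr_ge0// powR_ge0.
  apply: lee_wpmul2l; first by rewrite lee_fin powR_ge0.
  apply: lee_nneseries => [n _ _|n _]; first by rewrite lee_fin mulr_ge0// powR_ge0.
  rewrite /g -powRrM mulVf ?gt_eqF// powRr1; last by rewrite fine_ge0.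
  by rewrite EFinM (fineK (Knfin n)).
rewrite nneseriesZl; last by move=> n _; rewrite lee_fin.
(* [m] is written as [(m^p)^(1/p)], which gives both terms the shape required by
   [Lpnorm_root_le]. *)
rewrite powRM ?powR_ge0 ?fine_ge0// -powRrM divff ?gt_eqF// powRr1//.
rewrite mulrC EFinM; apply: lee_wpmul2l; first by rewrite lee_fin powR_ge0.
exact: hm.
Qed.

Lemma S_op_dist x :
  (`|S_op chi t w f x - sum_Z (fun k => chi (w * x - t k) (f x))| <=
  (m `^ (p - 1) * fine (J1 x)) `^ p^-1 + (m `^ p * fine (J2 x)) `^ p^-1)%R.
Proof.
rewrite -lee_fin; apply: le_trans (esum_chi_dist x).
have s2 : summable_Z (fun k => chi (w * x - t k)%R (f x)) by exact: chi1.
apply: (sum_Z_dist _ s2); rewrite /summable_Z.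
(* (chi1) concerns a second argument fixed in [k]. With [average k] in its place, summability
   follows by comparison with the constant argument [f x]. *)
apply: (@le_lt_trans _ _ (\esum_(k in [set: int])
  ((`|chi (w * x - t k) (average k) - chi (w * x - t k) (f x)|)%:E +
    (`|chi (w * x - t k) (f x)|)%:E))).
  apply: le_esum => k _; rewrite -EFinD lee_fin.
  by rewrite (le_trans _ (ler_normD _ _))// subrK.
rewrite esumD//.
by rewrite lte_add_pinfty// (le_lt_trans (esum_chi_dist x))// ltry.
Qed.

End pointwise.

(* From the pointwise bound to the norm estimate *)
Local Close Scope ereal_scope.
Unset Implicit Arguments. Set Strict Implicit.

Theorem theorem3p2 (R : realType) (p : R) (t : int -> R) (delta Delta : R)
    (chi : R -> R -> R) (L : R -> R) (M2 theta0 : R) :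
  1 <= p ->
  sampling_sequence t delta Delta ->
  (* (chi1) *)
  (forall (x u w : R), 0 < w -> summable_Z (fun k => chi (w * x - t k) u)) ->
  (* (chi2) *)
  (forall x : R, chi x 0 = 0) ->
  (* (chi3) with psi(u) = u *)
  measurable_fun [set: R] L -> (forall x, 0 <= L x) ->
  (forall x u v : R, `|chi x u - chi x v| <= L x * `|u - v|) ->
  (* (L1) *)
  lebesgue_measure.-integrable [set: R] (EFin \o L) ->
  (exists2 r : R, 0 < r & exists M : R, forall x : R, `|x| < r -> L x <= M) ->
  (* (L2) *)
  (exists2 beta0 : R, 0 < beta0 & exists B : R, forall u : R,
     (\esum_(k in [set: int]) (L (u - t k) * `|u - t k| `^ beta0)%:E <= B%:E)%E) ->
  (* M_p(L) < +oo *)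
  (Mp p L < +oo)%E ->
  (* T_w(x) <= M2 w^{-theta0} for all x and all sufficiently large w;
     this also gives (chi4) *)
  0 < M2 -> 0 < theta0 ->
  (\forall w \near +oo, forall x u : R, u != 0 ->
     `| u^-1 * sum_Z (fun k => chi (w * x - t k) u) - 1 | <= M2 * w `^ (- theta0)) ->
  forall f : R -> R, in_Lp p f ->
  \forall w \near +oo,
    (Lpnorm p (fun x => (S_op chi t w f x - f x)%R) <=
       (delta `^ (- p^-1) * (2 * m0 t L) `^ ((p - 1) / p)
          * (normL1 L + fine (Mp p L)) `^ p^-1)%:E * omega_p p f w^-1
     + (delta `^ (- p^-1) * m0 t L * Delta `^ p^-1)%:E * omega_p p f (Delta / w)
     + (M2 * w `^ (- theta0))%:E * Lpnorm p f)%E.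
Proof.
move=> p1 st chi1 chi2 mL L0 chi3 iL L1 L2 ML M20 th0 HT f Lf.
have p0 : 0 < p by exact: lt_le_trans p1.
have [mf foo] := Lf.
have delta0 : 0 < delta by case: st.
have Delta0 : 0 < Delta by case: st => d0 dD _ _; exact: lt_le_trans dD.
have hm := m0_ub st L0 L1 L2.
have m00 : 0 <= m0 t L by exact: m0_ge0.
apply: filterS2 HT (nbhs_pinfty_gt (num_real 0)) => w Tw w0.
set m := m0 t L in hm m00 *.
pose J1 := kernel_modulus p t L f w.
pose J2 := local_modulus p delta Delta f w.
pose G1 x := (m `^ (p - 1) * fine (J1 x)) `^ p^-1.
pose G2 x := (m `^ p * fine (J2 x)) `^ p^-1.
have mJ1 : measurable_fun [set: R] J1 by exact: measurable_kernel_modulus st mL L0 Lf w0.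
have mJ2 : measurable_fun [set: R] J2 by exact: measurable_local_modulus.
have mroot c (J : R -> \bar R) : measurable_fun [set: R] J ->
    measurable_fun [set: R] (fun x => (c * fine (J x)) `^ p^-1).
  move=> mJ; apply: (@measurableT_comp _ _ _ _ _ _ (@powR R ^~ p^-1)) => //.
  by apply: measurable_funM => //; exact: measurableT_comp.
have Tw0 : 0 <= M2 * w `^ (- theta0) by rewrite mulr_ge0 ?powR_ge0// ltW.
have dist x : `|S_op chi t w f x - f x| <= G1 x + G2 x + M2 * w `^ (- theta0) * `|f x|.
  rewrite -(subrKA (sum_Z (fun k => chi (w * x - t k) (f x)))).
  apply: (le_trans (ler_normD _ _)); apply: lerD.
    exact: (S_op_dist p1 st chi1 L0 chi3 hm Lf w0).
  (* The bound on [T_w] is over nonzero [u]; when [f x = 0], (chi2) makes every term of the sum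
     vanish. *)
  have [fx0|fx0] := eqVneq (f x) 0.
    rewrite fx0 normr0 mulr0 subr0.
    have z r : (\esum_(k in [set: int]) (Num.max (r * chi (w * x - t k) 0) 0)%:E = 0)%E.
      by apply: esum1 => k _; rewrite chi2 mulr0 maxxx.
    (* Positive and negative parts are the cases [r = 1] and [r = -1] of [z]. *)
    rewrite /sum_Z.
    have := z 1; under eq_esum do rewrite mul1r; move=> ->.
    have := z (-1); under eq_esum do rewrite mulN1r; move=> ->.
    by rewrite subrr normr0.
  set S := sum_Z _.
  have -> : S - f x = ((f x)^-1 * S - 1) * f x by field.
  by rewrite normrM ler_wpM2r//; exact: Tw.
apply: (le_trans (le_Lpnorm p1 dist)).
apply: (le_trans (@LpnormD _ p p1 (fun x => G1 x + G2 x)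
  (fun x => M2 * w `^ (- theta0) * `|f x|) _ _)).
- by apply: measurable_funD; exact: mroot.
- by apply: measurable_funM => //; exact: measurableT_comp.
apply: leeD; last first.
  rewrite LpnormZ//; last exact: measurableT_comp.
  by apply: lee_wpmul2l; rewrite ?lee_fin// !LpnormE;
    under eq_integral do rewrite normr_id.
apply: (le_trans (@LpnormD _ p p1 G1 G2 (mroot _ _ mJ1) (mroot _ _ mJ2))).
have w10 : 0 <= w^-1 by rewrite invr_ge0 ltW.
have Dw0 : 0 <= Delta / w by rewrite divr_ge0// ltW.
have S0 : 0 <= normL1 L + fine (Mp p L).
  rewrite addr_ge0//; apply/fine_ge0/integral_ge0 => x _; rewrite lee_fin//.
  by rewrite mulr_ge0// powR_ge0.
have dV : (delta^-1) `^ p^-1 = delta `^ (- p^-1).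
  by rewrite -(powR_inv1 (ltW delta0)) -powRrM mulN1r.
apply: leeD.
- apply: (le_trans (Lpnorm_root_le p1 (powR_ge0 _ _) mJ1 _ _
    (integral_kernel_modulus_le p1 st mL L0 Lf w0 iL ML))).
  + exact: (kernel_modulus_ge0 p f st L0 w0).
  + by move=> x; exact: (kernel_modulus_lty p1 st L0 Lf w0 x hm).
  rewrite -{2}(fineK (omega_p_fin_num p1 Lf w10)).
  set om := fine (omega_p p f w^-1).
  have om0 : 0 <= om by rewrite fine_ge0// omega_p_ge0.
  rewrite -EFinM lee_fin le_eqVlt; apply/orP; left; apply/eqP.
  (* Both sides are equal: [m^(p-1)] from Jensen and [2^(p-1)] from the kernel moment combine, under
     the [p]-th root, into [(2 m)^((p-1)/p)]. *)
  rewrite -dV (powRM _ (ler0n _ 2))//.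
  rewrite powRM ?powR_ge0 ?mulr_ge0 ?invr_ge0 ?powR_ge0 ?(ltW delta0)//.
  rewrite powRM ?powR_ge0 ?mulr_ge0 ?invr_ge0 ?powR_ge0 ?(ltW delta0)//.
  rewrite powRM ?powR_ge0 ?mulr_ge0 ?invr_ge0 ?powR_ge0 ?(ltW delta0)//.
  rewrite powRM ?powR_ge0 ?mulr_ge0 ?invr_ge0 ?powR_ge0 ?(ltW delta0)//.
  rewrite -!powRrM mulfV ?gt_eqF// powRr1//; ring.
- apply: (le_trans (Lpnorm_root_le p1 (powR_ge0 _ _) mJ2 _ _
    (integral_local_modulus_le p1 st Lf w0))).
  + exact: (local_modulus_ge0 p f st w0).
  + exact: (local_modulus_lty p1 st Lf w0).
  rewrite -{2}(fineK (omega_p_fin_num p1 Lf Dw0)).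
  set om := fine (omega_p p f (Delta / w)).
  have om0 : 0 <= om by rewrite fine_ge0// omega_p_ge0.
  rewrite -EFinM lee_fin le_eqVlt; apply/orP; left; apply/eqP.
  rewrite -dV.
  rewrite powRM ?powR_ge0 ?mulr_ge0 ?invr_ge0 ?powR_ge0 ?(ltW delta0) ?(ltW Delta0)//.
  rewrite powRM ?powR_ge0 ?mulr_ge0 ?invr_ge0 ?powR_ge0 ?(ltW delta0) ?(ltW Delta0)//.
  rewrite powRM ?powR_ge0 ?mulr_ge0 ?invr_ge0 ?powR_ge0 ?(ltW delta0) ?(ltW Delta0)//.
  rewrite -!powRrM mulfV ?gt_eqF// !powRr1//; ring.
Qed.
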